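(* Let $\mathcal{D}$ be a dyadic grid on $\mathbb{R}$ and let $s>1/2$. Then $H^s_{\mathcal{D}}(\mathbb{R})\subseteq L^\infty(\mathbb{R})$. In particular, there is a constant $C_s>0$ depending only on $s$ such that $$\|f\|_{L^\infty(\mathbb{R})}\leq C_s\|f\|_{H^s_{\mathcal{D}}(\mathbb{R})}$$ for any $f\in\mathscr{S}_{\mathcal{D}}(\mathbb{R})$.
   Context: A dyadic grid $\mathcal{D}$ on $\mathbb{R}$ is a collection of intervals such that: (D1) every $I\in\mathcal{D}$ has length $2^k$ for some $k\in\mathbb{Z}$; (D2) for any fixed $k_0\in\mathbb{Z}$, the intervals of $\mathcal{D}$ of length $2^{k_0}$ form a partition of $\mathbb{R}$; (D3) $I\cap J\in\{\varnothing,I,J\}$ for all $I,J\in\mathcal{D}$. $|\cdot|$ denotes Lebesgue measure. For $I\in\mathcal{D}$, $I_+$ and $I_-$ denote the right and left halves of $I$ (the two elements of $\mathcal{D}$ of length $|I|/2$ contained in $I$), and $h_I:=|I|^{-1/2}(\mathbf{1}_{I_+}-\mathbf{1}_{I_-})$ is the Haar function; $\{h_I\}_{I\in\mathcal{D}}$ is an orthonormal basis of $L^2(\mathbb{R})$. $\mathscr{S}_{\mathcal{D}}(\mathbb{R})$ is the linear span of $\{h_I: I\in\mathcal{D}\}$. Functions are real-valued and $(f,g):=\int_{\mathbb{R}}fg\,dx$. Put $$\|f\|_{\dot H^s_{\mathcal{D}}(\mathbb{R})}:=\Big(\sum_{I\in\mathcal{D}}|I|^{-2s}|(f,h_I)|^2\Big)^{1/2},\qquad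 \|f\|_{H^s_{\mathcal{D}}(\mathbb{R})}:=\big(\|f\|_{\dot H^s_{\mathcal{D}}(\mathbb{R})}^2+\|f\|_{L^2(\mathbb{R})}^2\big)^{1/2},$$ and $H^s_{\mathcal{D}}(\mathbb{R}):=\{f\in L^2(\mathbb{R}):\|f\|_{\dot H^s_{\mathcal{D}}(\mathbb{R})}<\infty\}$. *)

(* Defs.v *)
From HB Require Import structures.
From mathcomp Require Import all_boot all_order all_algebra.
From mathcomp Require Import all_classical all_reals all_analysis.

Set Implicit Arguments.
Unset Strict Implicit.
Unset Printing Implicit Defensive.

Import Order.TTheory GRing.Theory Num.Theory.
Import numFieldNormedType.Exports.

Local Open Scope classical_set_scope.
Local Open Scope ring_scope.

(* Nothing is assumed about which endpoints belong to the intervals. *)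
Definition dyadic_grid (R : realType) (D : set (set R)) : Prop :=
  [/\ (forall I, D I -> is_interval I /\
         exists k : int, lebesgue_measure I = ((2 : R) ^ k)%:E),
      (forall k0 : int,
         partition [set I | D I /\ lebesgue_measure I = ((2 : R) ^ k0)%:E]
           id [set: R])
    & (forall I J, D I -> D J ->
         [\/ I `&` J = set0, I `&` J = I | I `&` J = J])].

Definition len (R : realType) (I : set R) : R := fine (lebesgue_measure I).

Definition dyadic_children (R : realType) (D : set (set R)) (I : set R) :
    set (set R) :=
  [set J | [/\ D J, J `<=` I & len J = len I / 2]].

(* Of the two children of I, the right one is the one with the same supremum
   as I, and the left one is the one with the same infimum. When D is a dyadic
   grid and I is in D both exist and are unique, so that the default value set0
   is not used. *)
Definition right_half (R : realType) (D : set (set R)) (I : set R) : set R :=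
  xget set0 [set J | dyadic_children D I J /\ sup J = sup I].

Definition left_half (R : realType) (D : set (set R)) (I : set R) : set R :=
  xget set0 [set J | dyadic_children D I J /\ inf J = inf I].

Definition haar (R : realType) (D : set (set R)) (I : set R) : R -> R :=
  fun x => len I `^ (- 2^-1) * (\1_(right_half D I) x - \1_(left_half D I) x).

Definition linear_span (R : realType) (A : set (R -> R)) : set (R -> R) :=
  [set f | exists (n : nat) (c : 'I_n -> R) (g : 'I_n -> R -> R),
     (forall i, A (g i)) /\ f = (fun x => \sum_(i < n) c i * g i x)].

Definition haar_span (R : realType) (D : set (set R)) : set (R -> R) :=
  linear_span (haar D @` D).

Definition inner (R : realType) (f g : R -> R) : R :=
  \int[@lebesgue_measure R]_x (f x * g x).

Definition norm_L (R : realType) (p : \bar R) (f : R -> R) : \bar R :=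
  Lnorm (@lebesgue_measure R) p (EFin \o f).

(* The (unordered) sum over D is taken in [0, +oo]. *)
Definition norm_Hdot (R : realType) (D : set (set R)) (s : R) (f : R -> R) :
    \bar R :=
  ((\esum_(I in D) (len I `^ (- (2 * s)) * `|inner f (haar D I)| ^+ 2)%:E)
     `^ 2^-1)%E.

Definition norm_H (R : realType) (D : set (set R)) (s : R) (f : R -> R) :
    \bar R :=
  ((norm_Hdot D s f ^+ 2 + norm_L 2%:E f ^+ 2) `^ 2^-1)%E.

(* Lebesgue spaces and Sobolev spaces are sets of functions, not of classes
   modulo almost-everywhere equality; membership in them and the norms above do
   not depend on the (Borel) representative. *)
Definition L_space (R : realType) (p : \bar R) : set (R -> R) :=
  [set f | f \in Lfun (@lebesgue_measure R) p].

Definition H_space (R : realType) (D : set (set R)) (s : R) : set (R -> R) :=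
  [set f | L_space 2%:E f /\ (norm_Hdot D s f < +oo)%E].

(* Main.v *)
Require Import Defs.
From mathcomp Require Import all_boot all_order all_algebra.
From mathcomp Require Import all_classical all_reals all_analysis.
From mathcomp Require Import measurable_realfun ess_sup_inf ring lra.

Set Implicit Arguments.
Unset Strict Implicit.
Unset Printing Implicit Defensive.

Import Order.TTheory GRing.Theory Num.Theory.
Import numFieldNormedType.Exports.

Local Open Scope classical_set_scope.
Local Open Scope ring_scope.

(** Let I_n(x) be the interval of D of length 2^-n that contains x, and let
E_n f (x) be the mean of f over I_n(x).

A child J of I is a half of I, so the means of f over J and over I differ by
exactly |I|^(-1/2) |(f, h_I)| ([average_child]).  Every term of the series that
defines the homogeneous norm is at most its sum, so that
|(f, h_I)| <= |I|^s ||f||_Hdot ([haar_coefficient_le]), and therefore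
|E_(n+1) f - E_n f| <= |I_n|^(s - 1/2) ||f||_Hdot = q^n ||f||_Hdot with
q = 2^(1/2 - s).  For s > 1/2 this is a convergent geometric series.  As
|E_0 f| <= ||f||_2 by Cauchy-Schwarz on an interval of length 1, all means are
at most (1 + 1/(1 - q)) ||f||_H ([average_le]).

The intervals I_n(x) shrink nicely to x, hence E_n f (x) tends to f x for almost
every x by the Lebesgue differentiation theorem, and the same bound holds for
|f| almost everywhere ([L2_sup_le]).  The estimate is thus valid for every f in
L^2, in particular on the span of the Haar functions.

What remains is the geometry of the grid.  A child of I that touched neither
end of I would leave on each side a gap shorter than |I|/2, in which no other
child fits ([child_endpoints]).  So I has exactly two children, and they are its
left and right halves ([child_half], [halves_cover]). *)

(** * Intervals of finite length *)

Section Intervals.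
Context {R : realType}.
Implicit Types (I J : set R) (l x : R).

(** The measure is that of the hull of I, whose bounds are inf I and sup I when
I is bounded and infinite otherwise; a finite measure rules out the latter. *)
Lemma interval_endpoints I l : is_interval I -> 0 < l ->
  lebesgue_measure I = l%:E ->
  [/\ has_lbound I, has_ubound I & sup I = inf I + l].
Proof.
move=> itvI l0; rewrite [X in lebesgue_measure X](is_intervalP I).1//.
rewrite lebesgue_measure_itv /Rhull.
case: (asboolP (has_lbound I)) => lI; case: (asboolP (has_ubound I)) => uI //=.
- rewrite lte_fin; case: ifPn => _ [] E; last by rewrite -E ltxx in l0.
  by split=> //; rewrite -E; lra.
- by rewrite ltry.
- by rewrite ltNyr.
Qed.

Lemma interval_interior_mem I x : is_interval I -> has_lbound I ->
  has_ubound I -> inf I < x < sup I -> I x.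
Proof.
move=> itvI lI uI xI; apply: interior_subset.
by rewrite interval_bounded_interior.
Qed.

End Intervals.

(** * Children in a dyadic grid *)

Section Grid.
Context {R : realType} (D : set (set R)) (gridD : dyadic_grid D).
Implicit Types (I J : set R) (k : int) (x : R).

Definition generation k : set (set R) :=
  [set I | D I /\ lebesgue_measure I = ((2 : R) ^ k)%:E].

Lemma generation_mem k x : exists2 I, generation k I & I x.
Proof.
case: gridD => _ /(_ k)[cov _ _] _.
have : [set: R] x by [].
by rewrite -cov => -[I gI Ix]; exists I.
Qed.

Lemma generation_eq k I J x : generation k I -> generation k J ->
  I x -> J x -> I = J.
Proof.
case: gridD => _ /(_ k)[_ triv _] _ gI gJ Ix Jx.
by apply: (triv I J) => //; exists x.
Qed.

Lemma generation_len k I : generation k I -> len I = 2 ^ k.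
Proof. by move=> [_]; rewrite /len => ->. Qed.

Lemma generation_measurable k I : generation k I -> measurable I.
Proof.
by case: gridD => itv _ _ [/itv[+ _] _]; exact: is_interval_measurable.
Qed.

Lemma generation_endpoints k I : generation k I ->
  [/\ forall x, I x -> inf I <= x <= sup I,
      forall x, inf I < x < sup I -> I x & sup I = inf I + 2 ^ k].
Proof.
case: gridD => itv _ _ [/itv[itvI _] muI].
have [lI uI supI] := interval_endpoints itvI (exprz_gt0 k (ltr0Sn R 1)) muI.
split=> // x; last exact: interval_interior_mem.
by move=> Ix; rewrite ge_inf//= ub_le_sup.
Qed.

Lemma exprz_half k : (2 : R) ^ (k - 1) = 2 ^ k / 2.
Proof. by rewrite expfzDr ?pnatr_eq0// expr1z. Qed.

(** Of the three cases of nestedness, J cannot contain I because it is shorter,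
and the two are not disjoint because both contain x. *)
Lemma generation_nested k I J x : generation k I -> generation (k - 1) J ->
  I x -> J x -> J `<=` I.
Proof.
move=> gI gJ Ix Jx; case: gridD => _ _ /(_ I J gI.1 gJ.1)[IJ0|IJ|IJ].
- by have : (I `&` J) x by []; rewrite IJ0.
- have sIJ : (lebesgue_measure I <= lebesgue_measure J)%E.
    apply: le_measure; rewrite ?inE; [exact: (generation_measurable gI)|
      exact: (generation_measurable gJ)|by rewrite -IJ; exact: subIsetr].
  move: sIJ; rewrite gI.2 gJ.2 lee_fin exprz_half.
  have := exprz_gt0 k (ltr0Sn R 1); lra.
- by rewrite -IJ; exact: subIsetl.
Qed.

Lemma subset_endpoints k k' I J : generation k I -> generation k' J ->
  J `<=` I -> inf I <= inf J /\ sup J <= sup I.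
Proof.
move=> gI gJ JI; have [Ib _ _] := generation_endpoints gI.
have J0 : J !=set0 by case: gridD => _ /(_ k')[_ _ /(_ J gJ)].
split; first by apply: lb_le_inf => // x /JI /Ib /andP[].
by apply: ge_sup => // x /JI /Ib /andP[].
Qed.

(** If J touched neither end of I, the child K through a point of I to the left
of J would have length |I|/2 and start within I, so it would have to overlap J,
and then K = J. *)
Lemma child_endpoints k I J : generation k I -> generation (k - 1) J ->
  J `<=` I -> inf J = inf I \/ sup J = sup I.
Proof.
move=> gI gJ JI.
have [Ib Im Is] := generation_endpoints gI.
have [_ Jm Js] := generation_endpoints gJ.
have l0 := exprz_gt0 k (ltr0Sn R 1).
rewrite exprz_half in Js.
have [aJ bJ] := subset_endpoints gI gJ JI.
have [|neI] := eqVneq (inf J) (inf I); first by left.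
right; apply/eqP; rewrite eq_le bJ /= leNgt; apply/negP => supJ.
have ltI : inf I < inf J by rewrite lt_neqAle eq_sym neI.
pose x := (inf I + inf J) / 2.
have Ix : I x by apply: Im; rewrite /x; lra.
have [K gK Kx] := generation_mem (k - 1) x.
have [Kb Km Ks] := generation_endpoints gK.
have KI : K `<=` I := generation_nested gI gK Ix Kx.
rewrite exprz_half in Ks.
have /andP[Kx1 _] := Kb _ Kx; rewrite /x in Ix Kx Kx1.
have [aK _] := subset_endpoints gI gK KI.
(* K starts to the left of J but ends to the right of inf J, so y is in both *)
pose y := (inf J + sup K) / 2.
have yJ : inf J < y < sup J by rewrite /y; lra.
have yK : inf K < y < sup K by rewrite /y; lra.
have JK : J = K := generation_eq gJ gK (Jm _ yJ) (Km _ yK).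
by move: Kx1; rewrite -JK; lra.
Qed.

(** The measure of a member of the grid is finite, so its real length determines
its measure and hence its generation. *)
Lemma dyadic_childrenP k I J : generation k I ->
  dyadic_children D I J <-> generation (k - 1) J /\ J `<=` I.
Proof.
move=> gI; split.
  move=> [DJ JI]; case: gridD => /(_ J DJ)[_ [k' muJ]] _ _.
  rewrite (generation_len gI) /len muJ /= -exprz_half => E.
  by split=> //; split=> //; rewrite muJ E.
move=> [gJ JI]; split=> //; first by case: gJ.
by rewrite (generation_len gI) (generation_len gJ) exprz_half.
Qed.

(** The child through a point of the first half of I cannot end at sup I, so
by [child_endpoints] it starts at inf I; this shows that the default value of
[left_half] is not taken. *)
Lemma left_halfP k I : generation k I ->
  [/\ generation (k - 1) (left_half D I), left_half D I `<=` I
    & inf (left_half D I) = inf I].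
Proof.
move=> gI; rewrite /left_half.
case: xgetP => [_ _ [/(dyadic_childrenP _ gI)[gJ JI] eqJ] //|none]; exfalso.
have [_ Im Is] := generation_endpoints gI.
have l0 := exprz_gt0 k (ltr0Sn R 1).
have Ix : I (inf I + 2 ^ k / 4) by apply: Im; lra.
have [J gJ Jx] := generation_mem (k - 1) (inf I + 2 ^ k / 4).
have JI : J `<=` I := generation_nested gI gJ Ix Jx.
have [Jb _ Js] := generation_endpoints gJ; rewrite exprz_half in Js.
have := child_endpoints gI gJ JI; have := Jb _ Jx => Jx' [eqJ|eqJ].
  by apply: (none J); split=> //; apply/(dyadic_childrenP _ gI).
by move: Jx'; lra.
Qed.

Lemma right_halfP k I : generation k I ->
  [/\ generation (k - 1) (right_half D I), right_half D I `<=` I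
    & sup (right_half D I) = sup I].
Proof.
move=> gI; rewrite /right_half.
case: xgetP => [_ _ [/(dyadic_childrenP _ gI)[gJ JI] eqJ] //|none]; exfalso.
have [_ Im Is] := generation_endpoints gI.
have l0 := exprz_gt0 k (ltr0Sn R 1).
have Ix : I (sup I - 2 ^ k / 4) by apply: Im; lra.
have [J gJ Jx] := generation_mem (k - 1) (sup I - 2 ^ k / 4).
have JI : J `<=` I := generation_nested gI gJ Ix Jx.
have [Jb _ Js] := generation_endpoints gJ; rewrite exprz_half in Js.
have := child_endpoints gI gJ JI; have := Jb _ Jx => Jx' [eqJ|eqJ].
  by move: Jx'; lra.
by apply: (none J); split=> //; apply/(dyadic_childrenP _ gI).
Qed.

(** A child that shares an endpoint with one of the halves has the same interior
as it, so the two meet and are equal. *)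
Lemma child_half k I J : generation k I -> generation (k - 1) J -> J `<=` I ->
  J = left_half D I \/ J = right_half D I.
Proof.
move=> gI gJ JI.
have [gL _ Li] := left_halfP gI; have [gR _ Ri] := right_halfP gI.
have [_ Lm Ls] := generation_endpoints gL.
have [_ Rm Rs] := generation_endpoints gR.
have [_ Jm Js] := generation_endpoints gJ.
have l0 := exprz_gt0 (k - 1) (ltr0Sn R 1).
have [eqJ|eqJ] := child_endpoints gI gJ JI; [left|right].
  by apply: (generation_eq (x := (inf J + sup J) / 2) gJ gL);
    [apply: Jm|apply: Lm]; lra.
by apply: (generation_eq (x := (inf J + sup J) / 2) gJ gR);
  [apply: Jm|apply: Rm]; lra.
Qed.

Lemma halves_disjoint k I : generation k I ->
  [disjoint left_half D I & right_half D I].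
Proof.
move=> gI; apply/disj_setPS => x [Lx Rx].
have [gL _ Li] := left_halfP gI; have [gR _ Ri] := right_halfP gI.
have [_ _ Is] := generation_endpoints gI.
have [_ _ Ls] := generation_endpoints gL.
have l0 := exprz_gt0 k (ltr0Sn R 1).
have LR := generation_eq gL gR Lx Rx.
by rewrite exprz_half in Ls; move: Ri; rewrite -LR; lra.
Qed.

Lemma halves_cover k I : generation k I ->
  left_half D I `|` right_half D I = I.
Proof.
move=> gI; have [_ LI _] := left_halfP gI; have [_ RI _] := right_halfP gI.
apply/seteqP; split=> [x [/LI|/RI] //|x Ix].
have [J gJ Jx] := generation_mem (k - 1) x.
by have [<-|<-] := child_half gI gJ (generation_nested gI gJ Ix Jx);
  [left|right].
Qed.

End Grid.

(** * Square integrable functions *)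

Section SquareIntegrable.
Context {R : realType}.
Local Notation mu := (@lebesgue_measure R).
Implicit Types (f : R -> R) (A : set R).

Lemma Lfun_measurable (p : \bar R) f : L_space p f -> measurable_fun setT f.
Proof. by rewrite /L_space/= inE => /andP[]; rewrite inE. Qed.

Let one_le_two : (1 <= 2%:E :> \bar R)%E. Proof. by rewrite lee1n. Qed.

Lemma L2_0 : L_space 2%:E (fun=> 0 : R).
Proof. exact: (Lfun_submod_closed mu one_le_two).1. Qed.

Lemma L2_linear (a : R) f g : L_space 2%:E f -> L_space 2%:E g ->
  L_space 2%:E (fun x => a * f x + g x).
Proof. exact: (Lfun_submod_closed mu one_le_two).2. Qed.

Lemma Lnorm2_indic A : measurable A ->
  Lnorm mu 2%:E (EFin \o \1_A) = (mu A `^ 2^-1)%E.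
Proof.
move=> mA; rewrite unlock /Lnorm; congr (_ `^ _)%E.
have -> : mu A = mu (A `&` setT) by rewrite setIT.
rewrite -integral_indic//; apply: eq_integral => x _ /=.
rewrite indicE; case: (x \in A) => /=; first by rewrite normr1 powR1.
by rewrite normr0 powR0.
Qed.

Lemma indic_L2 A : measurable A -> (mu A < +oo)%E ->
  L_space 2%:E (\1_A : R -> R).
Proof.
move=> mA fA; rewrite /L_space/= inE; apply/andP; split; rewrite inE/=.
  exact: measurable_indic.
by rewrite /finite_norm Lnorm2_indic// poweR_lty.
Qed.

(** f times the indicator of A is a product of two functions in L^2. *)
Lemma L2_integrable f A : L_space 2%:E f -> measurable A -> (mu A < +oo)%E ->
  mu.-integrable A (EFin \o f).
Proof.
move=> f2 mA fA; apply: (integrable_mkcond (mu:=mu) (EFin \o f) mA).2.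
rewrite restrict_EFin patch_indic; apply/Lfun1_integrable.
by apply: Lfun2_mul_Lfun1; last exact: indic_L2.
Qed.

Lemma L2_locally_integrable f : L_space 2%:E f -> locally_integrable setT f.
Proof.
move=> f2; split; [exact: Lfun_measurable f2|exact: openT|move=> K _ cK].
have := L2_integrable f2 (compact_measurable cK) (compact_finite_measure cK).
by move/integrableP => [].
Qed.

(** Cauchy-Schwarz against the indicator of A. *)
Lemma normr_Rintegral_le_L2 f A : L_space 2%:E f -> measurable A ->
  (mu A < +oo)%E ->
  (`|\int[mu]_(x in A) f x|%:E <= norm_L 2%:E f * mu A `^ 2^-1)%E.
Proof.
move=> f2 mA fA; have iA := L2_integrable f2 mA fA.
have mf := Lfun_measurable f2.
rewrite EFin_normr_Rintegral//.
apply: (le_trans (le_abse_integral mu mA (f:=EFin \o f) _)).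
  by apply/measurable_EFinP; exact: measurable_funTS.
rewrite -Lnorm2_indic//.
have h : (2^-1 + 2^-1 : R) = 1 by lra.
apply: le_trans (hoelder mu mf (measurable_indic mA) _ _ h) => //.
rewrite Lnorm1 integral_mkcond le_eqVlt; apply/orP; left; apply/eqP.
apply: eq_integral => x _; rewrite patchE /= indicE; case: ifP => /= _.
  by rewrite mulr1.
by rewrite mulr0 normr0.
Qed.

End SquareIntegrable.

(** * Means over dyadic intervals and Haar coefficients *)

Section Averages.
Context {R : realType} (D : set (set R)) (gridD : dyadic_grid D).
Local Notation mu := (@lebesgue_measure R).
Implicit Types (f : R -> R) (I J : set R).

Definition average f I : R := (len I)^-1 * \int[mu]_(x in I) f x.

Lemma generation_fin k I : generation D k I -> (mu I < +oo)%E.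
Proof. by move=> [_ ->]; rewrite ltry. Qed.

Lemma haar_L2 k I : generation D k I -> L_space 2%:E (haar D I).
Proof.
move=> gI.
have [gL _ _] := left_halfP gridD gI; have [gR _ _] := right_halfP gridD gI.
have -> : haar D I = fun x => len I `^ (- 2^-1) * \1_(right_half D I) x +
    (- len I `^ (- 2^-1) * \1_(left_half D I) x + 0).
  by apply/funext => x; rewrite /haar; ring.
apply: L2_linear.
  by apply: indic_L2; [exact: generation_measurable gR|
                       exact: generation_fin gR].
apply: L2_linear; last exact: L2_0.
by apply: indic_L2; [exact: generation_measurable gL|exact: generation_fin gL].
Qed.

Lemma inner_haar f k I : L_space 2%:E f -> generation D k I ->
  inner f (haar D I) = len I `^ (- 2^-1) *
    (\int[mu]_(x in right_half D I) f x - \int[mu]_(x in left_half D I) f x).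
Proof.
move=> f2 gI.
have [gL _ _] := left_halfP gridD gI; have [gR _ _] := right_halfP gridD gI.
have mL := generation_measurable gridD gL.
have mR := generation_measurable gridD gR.
have iL := L2_integrable f2 mL (generation_fin gL).
have iR := L2_integrable f2 mR (generation_fin gR).
rewrite [X in _ * (X - _)]Rintegral_mkcond [X in _ * (_ - X)]Rintegral_mkcond.
have iL' : mu.-integrable setT (EFin \o (f \_ (left_half D I))).
  rewrite -restrict_EFin.
  exact: (integrable_mkcond (mu:=mu) (EFin \o f) mL).1.
have iR' : mu.-integrable setT (EFin \o (f \_ (right_half D I))).
  rewrite -restrict_EFin.
  exact: (integrable_mkcond (mu:=mu) (EFin \o f) mR).1.
rewrite -RintegralB// -RintegralZl//;
  last exact: (integrableB measurableT iR' iL').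
rewrite /inner; apply: eq_Rintegral => x _.
by rewrite /haar !patch_indic /=; ring.
Qed.

(** With a and b the integrals of f over the left and the right half, the mean
over I is (a + b) / |I|, the means over the halves are 2a / |I| and 2b / |I|, so
that both differences are (b - a) / |I| up to sign. *)
Lemma average_child f k I J : L_space 2%:E f -> generation D k I ->
  generation D (k - 1) J -> J `<=` I ->
  `|average f J - average f I| = len I `^ (- 2^-1) * `|inner f (haar D I)|.
Proof.
move=> f2 gI gJ JI; rewrite (inner_haar f2 gI).
have [gL LI _] := left_halfP gridD gI; have [gR RI _] := right_halfP gridD gI.
have mL := generation_measurable gridD gL.
have mR := generation_measurable gridD gR.
have mI := generation_measurable gridD gI.
have iI := L2_integrable f2 mI (generation_fin gI).
have intI : \int[mu]_(x in I) f x =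
    \int[mu]_(x in left_half D I) f x + \int[mu]_(x in right_half D I) f x.
  rewrite -Rintegral_setU ?(halves_cover gridD gI)//.
  exact: (halves_disjoint gridD gI).
have lI := generation_len gI.
have l0 : 0 < len I by rewrite lI exprz_gt0.
rewrite normrM mulrA (ger0_norm (powR_ge0 _ _)) -powRD; last first.
  by apply/implyP => _; rewrite gt_eqF.
rewrite (_ : - 2^-1 + - 2^-1 = -1); last lra.
rewrite powR_inv1 ?ltW//.
have lJ : len J = len I / 2 by rewrite (generation_len gJ) exprz_half lI.
rewrite /average lJ intI.
set a := \int[mu]_(x in left_half D I) f x.
set b := \int[mu]_(x in right_half D I) f x.
have -> : (len I)^-1 * `|b - a| = `|(len I)^-1 * (b - a)|.
  by rewrite normrM (gtr0_norm (x := (len I)^-1)) ?invr_gt0.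
have [->|->] := child_half gridD gI gJ JI; rewrite -/a -/b.
  rewrite distrC; congr (`|_|); field; by rewrite gt_eqF.
congr (`|_|); field; by rewrite gt_eqF.
Qed.

End Averages.

(** * The essential supremum *)

Section SupBound.
Context {R : realType} (D : set (set R)) (gridD : dyadic_grid D) (s : R).
Local Notation mu := (@lebesgue_measure R).
Implicit Types (f : R -> R) (I J : set R).

(** The left-hand side is the square root of a single term of the series. *)
Lemma haar_coefficient_le f I :
  D I -> ((len I `^ (- s) * `|inner f (haar D I)|)%:E <= norm_Hdot D s f)%E.
Proof.
move=> DI; rewrite /norm_Hdot.
set c := `|inner f (haar D I)|; have c0 : 0 <= c by exact: normr_ge0.
have -> : (len I `^ (- s) * c)%:E =
    ((len I `^ (- (2 * s)) * c ^+ 2)%:E `^ 2^-1)%E.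
  rewrite poweR_EFin powRM ?powR_ge0 ?exprn_ge0//.
  rewrite -powRrM -powR_mulrn// -powRrM divff// powRr1//.
  by congr (_ `^ _ * _)%:E; lra.
have term_ge0 J : (0 <= (len J `^ (- (2 * s)) *
    `|inner f (haar D J)| ^+ 2)%:E)%E.
  by rewrite lee_fin mulr_ge0 ?powR_ge0 ?exprn_ge0.
rewrite gt0_ler_poweR ?invr_ge0//.
- by rewrite in_itv/= leey term_ge0.
- by rewrite in_itv/= leey esum_ge0.
apply: esum_ge; exists [set I]; last by rewrite fsbig_set1.
by split; [exact: finite_set1|move=> _ ->].
Qed.

(** Passing to intervals of half the length multiplies |I|^(s - 1/2) by this
ratio. *)
Definition haar_ratio : R := 2 `^ (2^-1 - s).

Lemma haar_ratio_lt1 : 2^-1 < s -> haar_ratio < 1.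
Proof.
move=> hs; rewrite /haar_ratio /powR pnatr_eq0/= expR_lt1 pmulr_llt0; first lra.
by rewrite ln_gt0// ltr1n.
Qed.

(** Induction over the generations: the mean over an interval of length 1 is at
most the L^2 norm, and the step from generation - n to a child costs M times
the n-th power of the ratio.  The fraction is the partial sum of the geometric
series. *)
Lemma average_le f M n I : 2^-1 < s -> L_space 2%:E f ->
  (norm_L 2%:E f <= M%:E)%E -> (norm_Hdot D s f <= M%:E)%E ->
  generation D (- n%:Z) I ->
  `|average f I| <= M * (1 + (1 - haar_ratio ^+ n) / (1 - haar_ratio)).
Proof.
move=> hs f2 fM HM; have q1 := haar_ratio_lt1 hs.
elim: n I => [|n IHn] I gI.
  rewrite expr0 subrr mul0r addr0 mulr1 /average (generation_len gI).
  rewrite oppr0 expr0z invr1 mul1r -lee_fin; apply: le_trans fM.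
  have := normr_Rintegral_le_L2 f2 (generation_measurable gridD gI)
    (generation_fin gI).
  by case: gI => _ ->; rewrite oppr0 expr0z poweR1r mule1.
have [x Ix] : I !=set0 by case: gridD => _ /(_ (- n.+1%:Z))[_ _ /(_ I gI)].
have gI' : generation D (- n%:Z - 1) I.
  by rewrite (_ : - n%:Z - 1 = - n.+1%:Z)// -addn1 PoszD opprD.
have [K gK Kx] := generation_mem gridD (- n%:Z) x.
have IK := generation_nested gridD gK gI' Kx Ix.
have step := average_child gridD f2 gK gI' IK.
have coef : len K `^ (- s) * `|inner f (haar D K)| <= M.
  by rewrite -lee_fin; apply: le_trans HM; apply: haar_coefficient_le; case: gK.
have ratio : len K `^ (- 2^-1) = haar_ratio ^+ n * len K `^ (- s).
  rewrite -powR_mulrn ?powR_ge0// /haar_ratio -powRrM (generation_len gK).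
  rewrite -powR_intmul// -!powRrM -powRD; last by rewrite pnatr_eq0 implybT.
  by congr (_ `^ _); rewrite intrN; lra.
have stepM : `|average f I - average f K| <= M * haar_ratio ^+ n.
  by rewrite step ratio -mulrA mulrC ler_wpM2r// exprn_ge0// powR_ge0.
rewrite -(subrK (average f K) (average f I)).
apply: le_trans (ler_normD _ _) _.
apply: le_trans (lerD stepM (IHn K gK)) _.
rewrite le_eqVlt; apply/orP; left; apply/eqP; rewrite exprS; field.
by rewrite subr_eq0 gt_eqF.
Qed.

(** For 1/2 < s, the supremum over n of the factors in [average_le]. *)
Definition sup_const : R := 1 + (1 - haar_ratio)^-1.

Definition dyadic_nbhd (x : R) (n : nat) : set R :=
  xget set0 [set I | generation D (- n%:Z) I /\ I x].

Lemma dyadic_nbhdP x n :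
  generation D (- n%:Z) (dyadic_nbhd x n) /\ dyadic_nbhd x n x.
Proof.
rewrite /dyadic_nbhd; case: xgetP => [_ _ //|none]; exfalso.
by have [I gI Ix] := generation_mem gridD (- n%:Z) x; exact: (none I).
Qed.

Lemma expNz_half n : (2 : R) ^ (- n%:Z) = 2^-1 ^+ n.
Proof. by rewrite exprVn -exprnN. Qed.

Lemma dyadic_nbhd_shrinking x : nicely_shrinking x (dyadic_nbhd x).
Proof.
split=> [n|].
  by have [g _] := dyadic_nbhdP x n; exact: (generation_measurable gridD g).
have r0 n : 0 < geometric 2 (2^-1 : R) n by rewrite /= mulr_gt0// exprn_gt0.
(* balls are open, so the radius has to exceed the length 2^-n; with twice this
   length as radius, the ball has measure 4 times 2^-n *)
exists (4, fun n => PosNum (r0 n)); split => //=.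
- apply: cvg_geometric; rewrite ger0_norm; lra.
- move=> n y Iy; have [g Ix] := dyadic_nbhdP x n.
  have [bnd _ supE] := generation_endpoints gridD g.
  have p0 : (0 : R) < 2^-1 ^+ n by rewrite exprn_gt0.
  move: (bnd _ Ix) (bnd _ Iy); rewrite supE expNz_half /ball/= ltr_norml.
  lra.
move=> n; have [[_ ->] _] := dyadic_nbhdP x n.
rewrite lebesgue_measure_ball; last exact: ltW (r0 n).
rewrite -EFinM lee_fin expNz_half.
by rewrite le_eqVlt; apply/orP; left; apply/eqP; ring.
Qed.

(** The bound on the means passes to their limit, which is f x at every Lebesgue
point x of f. *)
Lemma L2_sup_le f M : 2^-1 < s -> L_space 2%:E f ->
  (norm_L 2%:E f <= M%:E)%E -> (norm_Hdot D s f <= M%:E)%E ->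
  (norm_L +oo%E f <= (sup_const * M)%:E)%E.
Proof.
move=> hs f2 fM HM; have q1 := haar_ratio_lt1 hs.
have M0 : 0 <= M by rewrite -lee_fin (le_trans _ fM)// Lnorm_ge0.
have C0 : 0 <= sup_const * M.
  by rewrite mulr_ge0// addr_ge0// invr_ge0 subr_ge0 ltW.
rewrite /norm_L unlock /Lnorm; case: ifP => // _; apply/ess_supP.
have lf := L2_locally_integrable f2.
have := lebesgue_differentiation lf.
apply: filterS; first exact: (ae_filter_ringOfSetsType mu).
move=> x fx /=.
have /cvg_abse := nice_lebesgue_differentiation dyadic_nbhd_shrinking lf fx.
apply: cvge_le; apply: nearW => n /=.
have [g _] := dyadic_nbhdP x n.
have iI := L2_integrable f2 (generation_measurable gridD g) (generation_fin g).
have -> : ((mu (dyadic_nbhd x n))^-1 *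
    \int[mu]_(y in dyadic_nbhd x n) (f y)%:E)%E =
    (average f (dyadic_nbhd x n))%:E.
  rewrite /average (generation_len g) EFinM /Rintegral fineK.
    by rewrite g.2 inver gt_eqF// exprz_gt0.
  by apply: integrable_fin_num => //; exact: (generation_measurable gridD g).
rewrite lee_fin; apply: le_trans (average_le hs f2 fM HM g) _.
rewrite mulrC ler_wpM2r// lerD2l -[leRHS]mul1r ler_wpM2r//.
  by rewrite invr_ge0 subr_ge0 ltW.
by rewrite lerBlDr lerDl exprn_ge0// powR_ge0.
Qed.

End SupBound.

(** * Comparison with the Sobolev norm *)

Section HNorm.
Context {R : realType} (s : R).
Implicit Types (f : R -> R) (D : set (set R)).

Lemma le_pythagoras (a b : \bar R) : (0 <= a)%E -> (0 <= b)%E ->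
  (a <= (a ^+ 2 + b ^+ 2) `^ 2^-1)%E.
Proof.
move=> a0 b0.
have sqr_ge0 (c : \bar R) : (0 <= c)%E -> (0 <= c ^+ 2)%E.
  by move=> c0; rewrite expe2 mule_ge0.
have {1}-> : a = ((a ^+ 2) `^ 2^-1)%E.
  case: a a0 => [r| |//]; last by rewrite expe2 mulyy poweRyr.
  rewrite lee_fin => r0; rewrite -EFin_expe poweR_EFin -powR_mulrn//.
  by rewrite -powRrM divff// powRr1.
rewrite gt0_ler_poweR ?invr_ge0//.
- by rewrite in_itv/= leey sqr_ge0.
- by rewrite in_itv/= leey adde_ge0 ?sqr_ge0.
- by rewrite leeDl ?sqr_ge0.
Qed.

Lemma norm_Hdot_le_norm_H D f : (norm_Hdot D s f <= norm_H D s f)%E.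
Proof. by apply: le_pythagoras; rewrite ?poweR_ge0 ?Lnorm_ge0. Qed.

Lemma norm_L2_le_norm_H D f : (norm_L 2%:E f <= norm_H D s f)%E.
Proof.
by rewrite /norm_H addeC; apply: le_pythagoras; rewrite ?poweR_ge0 ?Lnorm_ge0.
Qed.

Lemma sup_const_gt0 : 2^-1 < s -> 0 < sup_const s.
Proof.
by move=> hs; rewrite addr_gt0// invr_gt0 subr_gt0 haar_ratio_lt1.
Qed.

(** When the Sobolev norm is infinite, so is the right-hand side, because the
constant is positive. *)
Lemma norm_Loo_le D f : 2^-1 < s -> dyadic_grid D -> L_space 2%:E f ->
  (norm_L +oo%E f <= (sup_const s)%:E * norm_H D s f)%E.
Proof.
move=> hs gridD f2; have C0 := sup_const_gt0 hs.
have := norm_Hdot_le_norm_H D f; have := norm_L2_le_norm_H D f.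
have : (0 <= norm_H D s f)%E by exact: poweR_ge0.
case: (norm_H D s f) => [M| |//] _ fM HM.
  by rewrite -EFinM; exact: (L2_sup_le gridD hs).
by rewrite gt0_muley ?lte_fin// leey.
Qed.

Lemma haar_span_L2 D f : dyadic_grid D -> haar_span D f -> L_space 2%:E f.
Proof.
move=> gridD [n [c [g [gD ->]]]].
elim: n c g gD => [|n IHn] c g gD.
  by under eq_fun do rewrite big_ord0; exact: L2_0.
under eq_fun do rewrite big_ord_recl.
apply: L2_linear; last by apply: IHn => i; exact: gD.
have [I DI <-] := gD ord0; case: (gridD) => /(_ I DI)[_ [k muI]] _ _.
exact: (@haar_L2 _ D gridD k I (conj DI muI)).
Qed.

Lemma norm_H_lty D f : H_space D s f -> (norm_H D s f < +oo)%E.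
Proof.
move=> [f2 fH]; have f2y : (norm_L 2%:E f < +oo)%E.
  by move: f2; rewrite /L_space/= inE => /andP[_]; rewrite inE.
have sqr_lty (a : \bar R) : (0 <= a)%E -> (a < +oo)%E -> (a ^+ 2 < +oo)%E.
  by move=> a0 ay; rewrite expe2 lte_mul_pinfty// ge0_fin_numE.
apply: poweR_lty; apply: lte_add_pinfty; apply: sqr_lty => //.
- exact: poweR_ge0.
- exact: Lnorm_ge0.
Qed.

End HNorm.

Theorem proposition8 (R : realType) (s : R) (hs : 2^-1 < s) :
  (forall D : set (set R), dyadic_grid D ->
     H_space D s `<=` @L_space R +oo%E) /\
  (exists C : R, 0 < C /\
     forall D : set (set R), dyadic_grid D ->
     forall f : R -> R, haar_span D f ->
       (norm_L +oo%E f <= C%:E * norm_H D s f)%E).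
Proof.
split; last first.
  exists (sup_const s); split; first exact: sup_const_gt0.
  by move=> D gridD f fD; apply: norm_Loo_le => //; exact: haar_span_L2 fD.
move=> D gridD f fH; have f2 := fH.1.
rewrite /L_space/= inE; apply/andP; split; rewrite inE/=.
  exact: Lfun_measurable f2.
apply: le_lt_trans (norm_Loo_le hs gridD f2) _.
by rewrite lte_mul_pinfty// ?norm_H_lty// lee_fin ltW// sup_const_gt0.
Qed.
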